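(* Let $m_0\ge1$ be an integer with $2m_0<n$. Let $\beta_0>0$ and $z_0,v\in\mathbb{R}$. Consider the solution $(\beta,\omega,\zeta)$ of the first-order geodesic system for $\mathsf{SL}(n)$ with initial data \[\beta(0)=\beta_0^{1/(2m_0)}I_{2m_0}\oplus\beta_0^{-1/(n-2m_0)}I_{n-2m_0},\] \[\zeta(0)=\Big(\bigoplus_{i=1}^{m_0}z_0Z_2\Big)\oplus 0\,I_{n-2m_0},\] \[\omega(0)=\Big(\tfrac{1}{2m_0}v\,\beta_0^{-1/(2m_0)}I_{2m_0}\Big)\oplus\Big(-\tfrac{1}{n-2m_0}v\,\beta_0^{1/(n-2m_0)}I_{n-2m_0}\Big).\] Then the solution preserves the block diagonal form, with \[\beta(t)=\big(e^{b(t)/(2m_0)}I_{2m_0}\big)\oplus\big(e^{-b(t)/(n-2m_0)}I_{n-2m_0}\big),\] where $b(t)$ is an unbounded function. Furthermore: (i) if the constant $z_0\ne0$, then $\lim_{t\to\pm\infty}b(t)=-\infty$; (ii) if the constant $z_0=0$, then $b(t)$ is strictly monotonic and the image of $b$ contains the entire real line.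
   Context: The first-order geodesic system: for a geodesic $A(t)$ of $\mathsf{SL}(n)$ (with the Riemannian metric induced from the Hilbert-Schmidt inner product $\langle A,B\rangle=\operatorname{tr}(AB^T)$ on real $n\times n$ matrices), set $\beta=A^{-1}A^{-T}$, $\omega=A^TA'+(A^T)'A$, $\zeta=A^TA'-(A^T)'A$. Then $\beta$ is symmetric positive definite of determinant 1, $\omega$ is symmetric with $\operatorname{tr}(\beta\omega)=0$, $\zeta$ is antisymmetric, and \[\beta'=-\beta\omega\beta,\quad \zeta'=0,\quad \omega'=\tfrac12(\omega+\zeta)^T\beta(\omega+\zeta)+\tfrac12\frac{\operatorname{tr}\omega\beta\omega\beta}{\operatorname{tr}\beta}I+\tfrac12\frac{\operatorname{tr}\zeta\beta\zeta\beta}{\operatorname{tr}\beta}I.\] Here $I$ is the $n\times n$ identity, $I_k$ is the $k\times k$ identity, $Z_2=\begin{pmatrix}0&-1\\1&0\end{pmatrix}$, and $\oplus$ is the block-diagonal sum of matrices.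
   Formalization: When z_0 = v = 0 the solution is constant, so b(t) is neither unbounded nor strictly monotonic; the formal statement claims unboundedness of b only when z_0 ≠ 0 or v ≠ 0, and claims (ii) only when v ≠ 0. *)

(* Defs.v *)
From HB Require Import structures.
From mathcomp Require Import all_boot all_order all_algebra.
From mathcomp Require Import all_classical all_reals all_analysis.
Set Implicit Arguments.
Unset Strict Implicit.
Unset Printing Implicit Defensive.
Import Order.TTheory GRing.Theory Num.Theory.
Import numFieldNormedType.Exports.
Local Open Scope classical_set_scope.
Local Open Scope ring_scope.

(* The block-diagonal sum A (+) B, cast from size p + (n - p) to size n. *)
Definition dsum (R : realType) (n p : nat) (hp : (p <= n)%N)
    (A : 'M[R]_p) (B : 'M[R]_(n - p)) : 'M[R]_n :=
  castmx (subnKC hp, subnKC hp) (block_mx A 0 0 B).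

(* Z_2 = (0 -1; 1 0) *)
Definition Z2 (R : realType) : 'M[R]_2 := delta_mx 1 0 - delta_mx 0 1.

Lemma sum2E (m : nat) : (\sum_(i < m) 2 = 2 * m)%N.
Proof. by rewrite sum_nat_const card_ord mulnC. Qed.

Definition Z2sum (R : realType) (m : nat) (z : R) : 'M[R]_(2 * m) :=
  castmx (sum2E m, sum2E m) (\mxdiag_(i < m) (z *: Z2 R)).

(* On a matrix-valued curve, [is_derive t 1 A D] is A'(t) = D for the normed
   space structure of ['M[R]_n]; it amounts to differentiability of every
   entry. *)
Definition geodesic_system (R : realType) (n : nat)
    (beta omega zeta : R -> 'M[R]_n) : Prop :=
  forall t : R,
    [/\ is_derive t 1 beta (- (beta t *m omega t *m beta t)),
        is_derive t 1 zeta 0 &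
        is_derive t 1 omega
          (2^-1 *: ((omega t + zeta t)^T *m beta t *m (omega t + zeta t))
           + (2^-1 * (\tr (omega t *m beta t *m omega t *m beta t)
                      / \tr (beta t)))%:M
           + (2^-1 * (\tr (zeta t *m beta t *m zeta t *m beta t)
                      / \tr (beta t)))%:M)].

(* With a = e^b these are the coefficients e^(b/(2 m0)), e^(-b/(n - 2 m0)). *)
Definition beta_form (R : realType) (n m0 : nat) (hn : (2 * m0 < n)%N)
    (a : R) : 'M[R]_n :=
  dsum (ltnW hn) (a `^ (2 * m0)%:R^-1)%:M (a `^ (- (n - 2 * m0)%:R^-1))%:M.

Definition omega_form (R : realType) (n m0 : nat) (hn : (2 * m0 < n)%N)
    (a v : R) : 'M[R]_n :=
  dsum (ltnW hn)
    ((2 * m0)%:R^-1 * v * a `^ (- (2 * m0)%:R^-1))%:M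
    (- (n - 2 * m0)%:R^-1 * v * a `^ (n - 2 * m0)%:R^-1)%:M.

Definition zeta_form (R : realType) (n m0 : nat) (hn : (2 * m0 < n)%N)
    (z : R) : 'M[R]_n :=
  dsum (ltnW hn) (Z2sum m0 z) 0.

(* Main.v *)
Require Import Defs.
From HB Require Import structures.
From mathcomp Require Import all_boot all_order all_algebra.
From mathcomp Require Import all_classical all_reals all_analysis.
From mathcomp Require Import ring lra.
Import Order.TTheory GRing.Theory Num.Theory.
Import numFieldNormedType.Exports.
Local Open Scope classical_set_scope.
Local Open Scope ring_scope.

(* Write x = e^(b/p), y = e^(-b/q) with p = 2 m0, q = n - 2 m0. On block scalar
   matrices the geodesic system reduces to b' = - w together with a scalar
   equation for w' that conserves the squared speed
   E = w^2 G(b) + p z0^2 x, where G(b) = 1/(p x) + 1/(q y).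
   If z0 = 0, then b' = c / sqrt (G b), and G is bounded below, so b is a
   monotone bijection (or constant) obtained by quadrature. If z0 <> 0, then
   0 < x <= c := E / (p z0^2), and x = c / (1 + r^2) turns the system into
   r' = h(r) with h positive and bounded; hence r is an increasing bijection and
   b = p ln x tends to -oo at both ends. Every solution of the matrix system with
   the given initial data is the one so constructed: the right-hand side is
   locally Lipschitz wherever tr beta <> 0, so the set of times at which two
   solutions agree is open, closed and nonempty. *)

(** * Scalar autonomous equations *)

(** The integral over [[a, x]] vanishes for [x < a], so no fixed base point serves the whole line.
    The base is moved below both [x] and [0], and subtracting the integral up to [0] cancels its
    choice. *)
Lemma continuous_primitive {R : realType} {f : R -> R} : continuous f ->
  exists F : R -> R, forall x, is_derive x (1 : R) F (f x).
Proof.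
move=> cf; pose mu := @lebesgue_measure R.
have intf a b : mu.-integrable `[a, b] (EFin \o f).
  apply: continuous_compact_integrable; first exact: segment_compact.
  exact: continuous_subspaceT.
pose I a x := \int[mu]_(t in `[a, x]) f t.
have IB a a' x : a' <= a -> a <= x -> I a' x = I a' a + I a x.
  move=> a'a ax; rewrite [RHS]addrC; apply/eqP; rewrite -subr_eq; apply/eqP.
  rewrite /I Rintegral_itvB//.
  rewrite Rintegral_itv_obnd_cbnd//.
  by apply: integrableS (intf a x) => //; exact: subset_itv_oc_cc.
have Iind a a' x : a <= x -> a <= 0 -> a' <= x -> a' <= 0 ->
    I a x - I a 0 = I a' x - I a' 0.
  wlog a'a : a a' / a' <= a => [hw|] ax a0 a'x a'0.
    by have [/hw|/ltW/hw h] := leP a' a; [exact|rewrite h].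
  by rewrite (IB a a' x)// (IB a a' 0)//; lra.
exists (fun x => I (- `|x| - 1) x - I (- `|x| - 1) 0) => x.
(* This base lies below [- |y| - 1] for every [y] within distance 1 of [x], so it serves a whole
   neighbourhood of [x]. *)
pose a := - `|x| - 2.
have ax : a < x by have := ler_norm (- x); rewrite normrN /a; lra.
have xu : x < x + 1 by lra.
have [dI I'] := continuous_FTC1_closed xu (intf a (x + 1)) ax (cf x).
apply: (@near_eq_is_derive _ _ _ (fun y => I a y - I a 0)).
  near=> y.
  have yx : `|y - x| < 1.
    by rewrite distrC; near: y; apply: cvgr_dist_lt.
  have hy : `|y| < `|x| + 1.
    by rewrite -(subrK x y) (le_lt_trans (ler_normD _ _))//; lra.
  have y0 := normr_ge0 y; have x0 := normr_ge0 x.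
  have yn : - y <= `|y| by rewrite -normrN ler_norm.
  by apply: Iind; rewrite /a; lra.
have dIa : is_derive x (1 : R) (I a) (f x).
  by apply: DeriveDef; [exact: dI | rewrite -derive1E I'].
by have := is_deriveB dIa (is_derive_cst (I a 0) x 1); rewrite subr0.
Unshelve. all: by end_near. Qed.

Lemma is_derive_continuous {R : realType} {f df : R -> R} :
  (forall x, is_derive x (1 : R) f (df x)) -> continuous f.
Proof.
move=> d x; apply: differentiable_continuous; apply/derivable1_diffP.
by case: (d x).
Qed.

Lemma MVT_cc {R : realType} {f df : R -> R} {a b : R} :
  (forall x, is_derive x (1 : R) f (df x)) -> a <= b ->
  exists2 c, a <= c <= b & f b - f a = df c * (b - a).
Proof.
move=> d ab.
have [|c cab E] := @MVT_segment R f df a b ab (fun x _ => d x).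
  by apply: continuous_subspaceT; exact: is_derive_continuous d.
by exists c.
Qed.

(** Separation of variables: [H x], the integral of [1 / h] from [r0] to [x], is the time at which
    the solution reaches [x]. Its slope is at least [1 / C], so [H] is onto and its inverse is a
    solution for all times. *)
Lemma autonomous_flow {R : realType} (h : R -> R) (C r0 : R) :
  continuous h -> (forall x, 0 < h x) -> (forall x, h x <= C) ->
  exists phi : R -> R, [/\ phi 0 = r0,
    forall t, is_derive t (1 : R) phi (h (phi t)),
    {homo phi : s t / s < t} & forall y, exists t, phi t = y].
Proof.
move=> ch h0 hC.
have C0 : 0 < C by exact: lt_le_trans (h0 0) (hC 0).
have ci : continuous (fun x => (h x)^-1).
  by move=> x; apply: cvgV; [rewrite gt_eqF | exact: ch].
have [F dF] := continuous_primitive ci.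
pose H x := F x - F r0.
have dH x : is_derive x (1 : R) H (h x)^-1.
  by have := is_deriveB (dF x) (is_derive_cst (F r0) x 1); rewrite subr0.
have cH := is_derive_continuous dH.
have Hgrow x y : x <= y -> (y - x) / C <= H y - H x.
  move=> xy; have [c _ ->] := MVT_cc dH xy.
  rewrite mulrC ler_wpM2r ?subr_ge0// lef_pV2 ?posrE//.
have Hinc x y : x < y -> H x < H y.
  move=> xy; rewrite -subr_gt0; apply: lt_le_trans (Hgrow _ _ (ltW xy)).
  by rewrite divr_gt0 ?subr_gt0.
have Hinj : injective H.
  move=> x y; case: (ltgtP x y) => // /Hinc + E.
    by rewrite E ltxx.
  by rewrite E ltxx.
have Hr0 : H r0 = 0 by rewrite /H subrr.
have Hsurj y : exists x, H x = y.
  (* At distance [d] from [r0], on either side, [H] has moved by at least [|y|], so [y] lies between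
     its two values there. *)
  pose d := C * `|y|.
  have d0 : 0 <= d by rewrite mulr_ge0// ltW.
  have dC : d / C = `|y| by rewrite /d mulrAC mulfV ?gt_eqF// mul1r.
  have h1 : `|y| <= H r0 - H (r0 - d).
    by rewrite -dC -[X in X / C](subKr r0 d); apply: Hgrow; lra.
  have h2 : `|y| <= H (r0 + d) - H r0.
    by rewrite -dC -[X in X / C](addKr r0 d) [- r0 + _]addrC; apply: Hgrow; lra.
  rewrite Hr0 in h1 h2.
  have [|||x _ Hx] := @IVT R H (r0 - d) (r0 + d) y.
  - by lra.
  - exact: continuous_subspaceT.
  - have yn : - y <= `|y| by rewrite -normrN ler_norm.
    have yp := ler_norm y.
    by rewrite ge_min le_max; apply/andP; split; apply/orP; [left|right]; lra.
  by exists x.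
have [phi phiH] := choice Hsurj.
have Hphi : cancel H phi by move=> x; exact: Hinj.
exists phi; split.
- by rewrite -Hr0 Hphi.
- move=> t; rewrite -{1}(phiH t) -[h _]invrK.
  apply: is_derive_inverse => //.
  + by near=> y; exact: Hphi.
  + by near=> y; exact: cH.
  + by rewrite invr_eq0 gt_eqF.
- move=> s t st; rewrite ltNge; apply/negP; rewrite le_eqVlt => /orP[/eqP E|].
    by move: st; rewrite -(phiH s) -(phiH t) E ltxx.
  by move=> /Hinc; rewrite !phiH ltNge => /negP; apply; exact: ltW.
- by move=> y; exists (H y).
Unshelve. all: by end_near. Qed.

(** * The reduced system *)

Lemma is_derive_comp {R : realType} {f g : R -> R} {t a b : R} :
  is_derive t (1 : R) g b -> is_derive (g t) (1 : R) f a ->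
  is_derive t (1 : R) (fun s => f (g s)) (a * b).
Proof. by move=> dg df; exact: is_derive1_comp. Qed.

Lemma is_derive_mul {R : realType} {f g : R -> R} {t a b : R} :
  is_derive t (1 : R) f a -> is_derive t (1 : R) g b ->
  is_derive t (1 : R) (fun s => f s * g s) (a * g t + f t * b).
Proof.
move=> df dg; have := is_deriveM df dg; move=> /is_derive_eq; apply.
by rewrite addrC /GRing.scale /= mulrC.
Qed.

Lemma is_derive_scale {R : realType} {f : R -> R} {t a : R} (c : R) :
  is_derive t (1 : R) f a -> is_derive t (1 : R) (fun s => c * f s) (c * a).
Proof. exact: is_deriveZ. Qed.

Lemma is_derive_inv {R : realType} {f : R -> R} {t a : R} :
  is_derive t (1 : R) f a -> f t != 0 ->
  is_derive t (1 : R) (fun s => (f s)^-1) (- a / f t ^+ 2).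
Proof.
move=> df f0; have := is_deriveV f0 df.
by move=> /is_derive_eq; apply; rewrite /GRing.scale /= mulNr mulrC mulNr.
Qed.

Section ReducedSystem.
Context {R : realType}.
Implicit Types (p q b w z t : R).

(* [kinetic p q b * w ^+ 2] and [p * z ^+ 2 * expR (b / p)] are the two parts of
   the conserved squared speed of the geodesic. *)
Definition kinetic p q b : R := p^-1 * expR (- b / p) + q^-1 * expR (b / q).

Definition dkinetic p q b : R :=
  q^-1 ^+ 2 * expR (b / q) - p^-1 ^+ 2 * expR (- b / p).

(** The value of [w'] found by differentiating [w ^+ 2 * kinetic p q b + p * z ^+ 2 * expR (b / p)]
    along [b' = - w], equating to 0 and cancelling [w]. *)
Definition accel p q z b w : R :=
  (w ^+ 2 * dkinetic p q b + z ^+ 2 * expR (b / p)) / (2 * kinetic p q b).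

Lemma kinetic_gt0 p q b : 0 < p -> 0 < q -> 0 < kinetic p q b.
Proof. by move=> p0 q0; rewrite addr_gt0// mulr_gt0 ?invr_gt0 ?expR_gt0. Qed.

Lemma is_derive_kinetic p q b :
  is_derive b (1 : R) (kinetic p q) (dkinetic p q b).
Proof.
have d1 : is_derive b (1 : R) (fun x => - x / p) (- p^-1).
  have := is_derive_scale (- p^-1) (is_derive_id b (1 : R)).
  rewrite mulr1; congr (is_derive _ _ _ _).
  by apply/funext => x; rewrite mulrC mulrN mulNr.
have d2 : is_derive b (1 : R) (fun x => x / q) (q^-1).
  have := is_derive_scale (q^-1) (is_derive_id b (1 : R)).
  rewrite mulr1; congr (is_derive _ _ _ _).
  by apply/funext => x; rewrite mulrC.
have := is_deriveD
  (is_derive_scale p^-1 (is_derive_comp d1 (is_derive_expR _)))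
  (is_derive_scale q^-1 (is_derive_comp d2 (is_derive_expR _))).
by move=> /is_derive_eq; apply; rewrite /dkinetic; ring.
Qed.

Lemma is_derive_sqrt_kinetic p q b : 0 < p -> 0 < q ->
  is_derive b (1 : R) (fun x => Num.sqrt (kinetic p q x))
    (dkinetic p q b / (2 * Num.sqrt (kinetic p q b))).
Proof.
move=> p0 q0; have := is_derive_comp
  (is_derive_kinetic p q b) (is_derive1_sqrt (kinetic_gt0 p q b p0 q0)).
by rewrite mulrC.
Qed.

Lemma is_derive_sqrD1 (r : R) :
  is_derive r (1 : R) (fun x => 1 + x ^+ 2) (2 * r).
Proof.
have := is_deriveD (is_derive_cst (1 : R) r 1)
                   (is_deriveX 2 (is_derive_id r (1 : R))).
by move=> /is_derive_eq; apply; rewrite add0r /GRing.scale /= expr1 mulr1.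
Qed.

Lemma is_derive_ln_sqrD1 (r : R) :
  is_derive r (1 : R) (fun x => ln (1 + x ^+ 2)) (2 * r / (1 + r ^+ 2)).
Proof.
have r0 : 0 < 1 + r ^+ 2 by rewrite ltr_pwDl// sqr_ge0.
have := is_derive_comp (is_derive_sqrD1 r) (is_derive1_ln r0).
move=> /is_derive_eq; apply.
by rewrite mulrC.
Qed.

Lemma is_derive_sqrt_sqrD1 (r : R) :
  is_derive r (1 : R) (fun x => Num.sqrt (1 + x ^+ 2))
    (r / Num.sqrt (1 + r ^+ 2)).
Proof.
have r0 : 0 < 1 + r ^+ 2 by rewrite ltr_pwDl// sqr_ge0.
have := is_derive_comp (is_derive_sqrD1 r) (is_derive1_sqrt r0).
move=> /is_derive_eq; apply.
by field; rewrite gt_eqF// sqrtr_gt0.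
Qed.

(* Without rotation the speed [Num.sqrt (kinetic b) * b'] is conserved. *)
Lemma reduced_solution_free p q b0 v : 0 < p -> 0 < q ->
  exists b w : R -> R, [/\ b 0 = b0, w 0 = v,
    forall t, is_derive t (1 : R) b (- w t),
    forall t, is_derive t (1 : R) w (accel p q 0 (b t) (w t)) &
    v != 0 -> ({homo b : s t / s < t} \/ {homo b : s t /~ s < t}) /\
              forall y, exists t, b t = y].
Proof.
move=> p0 q0; pose g x := Num.sqrt (kinetic p q x).
have g0 x : 0 < g x by rewrite sqrtr_gt0 kinetic_gt0.
have dg x : is_derive x (1 : R) g (dkinetic p q x / (2 * g x)).
  exact: is_derive_sqrt_kinetic.
have cg := is_derive_continuous dg.
have [|||phi [phi0 dphi phi_inc phi_surj]] :=
    @autonomous_flow R (fun x => (g x)^-1) (Num.sqrt p + Num.sqrt q) b0.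
- by move=> x; apply: cvgV; [rewrite gt_eqF|exact: cg].
- by move=> x; rewrite invr_gt0.
- move=> x; have e1 := expR_gt0 (- x / p); have e2 := expR_gt0 (x / q).
  (* Whatever the sign of [x], one of the two exponentials in [kinetic] is at least 1, so [kinetic]
     is at least [p^-1] or [q^-1]. *)
  have bound a : 0 < a -> a^-1 <= kinetic p q x -> (g x)^-1 <= Num.sqrt a.
    move=> a0 ax; rewrite -sqrtrV; last by rewrite ltW// kinetic_gt0.
    rewrite ler_wsqrtr// -[leRHS]invrK lef_pV2// posrE ?kinetic_gt0//.
    by rewrite invr_gt0.
  have [x0|x0] := leP x 0.
    apply: (@le_trans _ _ (Num.sqrt p)); last by rewrite lerDl sqrtr_ge0.
    apply: bound => //; rewrite -[leLHS]addr0 lerD//; last first.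
      by rewrite mulr_ge0 ?invr_ge0 ?ltW.
    rewrite ler_peMr ?invr_ge0 ?(ltW p0)// -expR0 ler_expR.
    by rewrite mulr_ge0 ?oppr_ge0 ?invr_ge0 ?(ltW p0).
  apply: (@le_trans _ _ (Num.sqrt q)); last by rewrite lerDr sqrtr_ge0.
  apply: bound => //; rewrite -[leLHS]add0r lerD//.
    by rewrite mulr_ge0 ?invr_ge0 ?ltW.
  rewrite ler_peMr ?invr_ge0 ?(ltW q0)// -expR0 ler_expR.
  by rewrite mulr_ge0 ?invr_ge0 ?ltW.
(* The flow of [1 / g] only increases, so sign and speed go into the time scale: [b' = c / g b]
   starts with slope [- v]. For [c = 0] the solution is constant. *)
pose c := - v * g b0.
have db t : is_derive t (1 : R) (fun t => phi (c * t)) (c / g (phi (c * t))).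
  have := is_derive_comp (is_derive_scale c (is_derive_id t (1 : R)))
                            (dphi (c * t)).
  by rewrite mulr1 mulrC.
exists (fun t => phi (c * t)), (fun t => - c / g (phi (c * t))).
split.
- by rewrite mulr0.
- by rewrite mulr0 phi0 /c -[- (- v * _)]mulNr opprK mulfK// gt_eqF.
- by move=> t; have := db t; rewrite mulNr opprK.
- move=> t; set f := phi (c * t).
  have gf0 : g f != 0 by rewrite gt_eqF.
  have dgb := is_derive_comp (db t) (dg f).
  have := is_derive_scale (- c) (is_derive_inv dgb gf0).
  move=> /is_derive_eq; apply; rewrite -/f /accel /GRing.scale /=.
  have -> : kinetic p q f = g f ^+ 2 by rewrite sqr_sqrtr// ltW// kinetic_gt0.
  by field.
- move=> v0; have c0 : c != 0 by rewrite mulf_neq0 ?oppr_eq0// gt_eqF.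
  split.
    have [cn|cp] := ltP c 0; [right|left] => s t st; apply: phi_inc.
      by rewrite ltr_nM2l.
    by rewrite ltr_pM2l// lt_def c0.
  move=> y; have [s <-] := phi_surj y; exists (s / c).
  by rewrite mulrCA mulfV// mulr1.
Qed.

(* The conserved squared speed [e ^+ 2] confines [expR (b / p)] to
   ]0, c], so that [expR (b / p) = c / (1 + r ^+ 2)]; the new unknown [r]
   satisfies a scalar autonomous equation with bounded positive right-hand
   side. *)
Lemma reduced_solution_rotating p q z b0 v : 0 < p -> 0 < q -> z != 0 ->
  exists b w : R -> R, [/\ b 0 = b0, w 0 = v,
    forall t, is_derive t (1 : R) b (- w t),
    forall t, is_derive t (1 : R) w (accel p q z (b t) (w t)) &
    (b t @[t --> +oo] --> -oo) /\ (b t @[t --> -oo] --> -oo)].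
Proof.
move=> p0 q0 z0.
pose x0 := expR (b0 / p); pose m := p * z ^+ 2.
have m0 : 0 < m by rewrite mulr_gt0// exprn_even_gt0.
have x00 : 0 < x0 by exact: expR_gt0.
pose E := v ^+ 2 * kinetic p q b0 + m * x0.
have E0 : 0 < E.
  apply: ltr_wpDl; last exact: mulr_gt0.
  by rewrite mulr_ge0 ?sqr_ge0// ltW// kinetic_gt0.
(* [e] is the conserved speed; [c] is the value that [expR (b / p)] has where [w = 0]. *)
pose e := Num.sqrt E; pose c := E / m.
have e0 : 0 < e by rewrite sqrtr_gt0.
have e2 : e ^+ 2 = E by rewrite sqr_sqrtr// ltW.
have c0 : 0 < c by rewrite divr_gt0.
pose B r := p * (ln c - ln (1 + r ^+ 2)).
have r1 (r : R) : 0 < 1 + r ^+ 2 by rewrite ltr_pwDl// sqr_ge0.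
have BE r : expR (B r / p) = c / (1 + r ^+ 2).
  rewrite /B mulrC mulrA mulVf ?gt_eqF// mul1r.
  by rewrite expRD expRN !lnK// posrE.
have dB r : is_derive r (1 : R) B (- (2 * p * r / (1 + r ^+ 2))).
  have := is_derive_scale p (is_deriveB (is_derive_cst (ln c) r (1 : R))
            (is_derive_ln_sqrD1 r)).
  move=> /is_derive_eq; apply; rewrite sub0r; field.
  by rewrite gt_eqF.
pose g b := Num.sqrt (kinetic p q b).
have g0 b : 0 < g b by rewrite sqrtr_gt0 kinetic_gt0.
have gE b : g b ^+ 2 = kinetic p q b by rewrite sqr_sqrtr// ltW// kinetic_gt0.
have dg b : is_derive b (1 : R) g (dkinetic p q b / (2 * g b)).
  exact: is_derive_sqrt_kinetic.
pose s (r : R) := Num.sqrt (1 + r ^+ 2).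
have s0 r : 0 < s r by rewrite sqrtr_gt0.
have sE r : s r ^+ 2 = 1 + r ^+ 2 by rewrite sqr_sqrtr// ltW.
have ds r : is_derive r (1 : R) s (r / s r) by exact: is_derive_sqrt_sqrD1.
(* Conservation gives [w = e * r / (s r * g (B r))]. In [- w = B' * r'] the factor [r] then cancels,
   leaving [r' = h r] with [h] positive even at the turning point [r = 0]. *)
pose h r := e / (2 * p) * (s r / g (B r)).
(* The solution of [1 + r0 ^+ 2 = c / x0] with the sign of [v]. *)
pose r0 := v * Num.sqrt (kinetic p q b0 / (m * x0)).
have [|||phi [phi0 dphi phi_inc phi_surj]] :=
    @autonomous_flow R h (e / (2 * p) * Num.sqrt (p * c)) r0.
- move=> r; apply: cvgM; first exact: cvg_cst.
  apply: cvgM; first exact: is_derive_continuous ds r.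
  apply: cvgV; first by rewrite gt_eqF.
  exact: (is_derive_continuous (fun r => is_derive_comp (dB r) (dg (B r)))).
- by move=> r; rewrite mulr_gt0 ?divr_gt0 ?mulr_gt0.
- move=> r; rewrite ler_wpM2l//; first by rewrite ltW// divr_gt0 ?mulr_gt0.
  (* After squaring, the first term of [kinetic] suffices: it equals [(1 + r ^+ 2) / (p * c)]. *)
  rewrite -(@ler_pXn2r _ 2) ?nnegrE ?sqrtr_ge0//; last first.
    by rewrite divr_ge0// ltW.
  rewrite expr_div_n sE gE sqr_sqrtr; last by rewrite ltW// mulr_gt0.
  rewrite ler_pdivrMr ?kinetic_gt0// /kinetic mulNr expRN BE.
  have := expR_gt0 (B r / q).
  set u := expR _ => u0.
  rewrite mulrDr; have -> : p * c * (p^-1 * (c / (1 + r ^+ 2))^-1) = 1 + r ^+ 2.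
    by field; rewrite !gt_eqF.
  by rewrite lerDl !mulr_ge0// ?invr_ge0 ltW.
pose b t := B (phi t); pose w t := 2 * p * phi t / (1 + phi t ^+ 2) * h (phi t).
have wE t : w t = e * phi t * ((s (phi t))^-1 * (g (b t))^-1).
  rewrite /w /h -sE -/(b t); field.
  by rewrite !gt_eqF.
have db t : is_derive t (1 : R) b (- w t).
  have := is_derive_comp (dphi t) (dB (phi t)).
  by rewrite mulNr.
have b00 : 1 + r0 ^+ 2 = c / x0.
  rewrite /r0 exprMn sqr_sqrtr; last first.
    by rewrite divr_ge0 ?ltW ?kinetic_gt0// mulr_gt0.
  by rewrite /c /E; field; rewrite !gt_eqF.
have b0E : b 0 = b0.
  rewrite /b phi0 /B b00 lnM ?posrE ?invr_gt0// lnV ?posrE// expRK.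
  by field; rewrite gt_eqF.
(* [B r <= A] means [c * expR (- A / p) <= 1 + r ^+ 2]. The extra 1 in the threshold ensures
   [|r| <= r ^+ 2]. *)
have B_le A : exists2 M : R, 0 < M & forall r, M < `|r| -> B r <= A.
  exists (1 + c * expR (- A / p)) => [|r rM].
    by rewrite addr_gt0// mulr_gt0 ?expR_gt0.
  set k := c * _ in rM; have k0 : 0 < k by rewrite mulr_gt0 ?expR_gt0.
  have rk : k <= 1 + r ^+ 2.
    by rewrite -real_normK ?num_real//; nra.
  have := rk; rewrite -ler_ln ?posrE// lnM ?posrE ?expR_gt0// expRK => lnk.
  rewrite /B -ler_pdivlMl//; lra.
exists b, w; split; [exact: b0E| |exact: db| |].
- have eE : e * Num.sqrt (kinetic p q b0 / (m * x0)) = s (phi 0) * g b0.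
    rewrite /e /s /g phi0 b00 -!sqrtrM ?ltW// ?divr_gt0//.
    by congr Num.sqrt; rewrite /c; field; rewrite !gt_eqF.
  rewrite wE b0E {1}phi0 /r0 [e * _]mulrCA eE -invfM mulfK//.
  by rewrite mulf_neq0// gt_eqF.
- move=> t.
  have dp := dphi t; have dst := is_derive_comp dp (ds (phi t)).
  have dgt := is_derive_comp (db t) (dg (b t)).
  have sn0 : s (phi t) != 0 by rewrite gt_eqF.
  have gn0 : g (b t) != 0 by rewrite gt_eqF.
  have := is_derive_mul (is_derive_scale e dp)
    (is_derive_mul (is_derive_inv dst sn0) (is_derive_inv dgt gn0)).
  rewrite -(funext wE) => /is_derive_eq; apply.
  (* The factor [s ^+ 2 - phi ^+ 2] equals 1; kept in this form, it makes the equation for [w'] an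
     identity in [s] and [phi] as independent variables. *)
  have zx : z ^+ 2 * expR (b t / p) =
            e ^+ 2 * (s (phi t) ^+ 2 - phi t ^+ 2) / (p * s (phi t) ^+ 2).
    by rewrite BE sE e2 addrK /c /m; field; rewrite z0 !gt_eqF.
  rewrite /accel zx -gE wE /h -/(b t); field.
  by rewrite sn0 gn0 gt_eqF.
(* [phi] is increasing and onto, so at each end of time it stays beyond any threshold, where [B] is
   below [A]. *)
- split.
  + apply/cvgrNyPle => A; have [M M0 BM] := B_le A.
    have [t0 t0M] := phi_surj M.
    near=> t; apply: BM; apply: lt_le_trans (ler_norm _).
    rewrite -t0M; apply: phi_inc; near: t; exact: nbhs_pinfty_gt (num_real _).
  + apply/cvgrNyPle => A; have [M M0 BM] := B_le A.
    have [t0 t0M] := phi_surj (- M).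
    near=> t; apply: BM; rewrite -normrN; apply: lt_le_trans (ler_norm _).
    rewrite ltrNr -t0M; apply: phi_inc; near: t; exact: nbhs_ninfty_lt (num_real _).
Unshelve. all: by end_near. Qed.
End ReducedSystem.

(** * Uniqueness for the geodesic system *)

Lemma is_derive_mxP {R : realType} {m n : nat} (M : R -> 'M[R]_(m, n)) (t : R)
    (D : 'M[R]_(m, n)) :
  is_derive t 1 M D <->
  forall i j, is_derive t (1 : R) (fun s => M s i j) (D i j).
Proof.
split=> [[dM MD] i j|dM].
  apply: DeriveDef; first exact: (derivable_mxP _ _ _).1 dM i j.
  by rewrite -MD derive_mx// mxE.
have dM' : derivable M t 1 by apply/derivable_mxP => i j; case: (dM i j).
apply: DeriveDef => //; rewrite derive_mx//.
by apply/matrixP => i j; rewrite mxE; case: (dM i j).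
Qed.

(** Near [t0], [e t * expR (- C * t)] cannot increase to the right and [e t * expR (C * t)] cannot
    decrease to the left. Both are nonnegative and vanish at [t0]. *)
Lemma gronwall_eq0 {R : realType} {e de : R -> R} {C t0 : R} :
  (forall t, is_derive t (1 : R) e (de t)) -> (forall t, 0 <= e t) ->
  e t0 = 0 -> (\forall t \near t0, `|de t| <= C * e t) ->
  \forall t \near t0, e t = 0.
Proof.
move=> d e_ge0 et0 [r /= r0 deC].
have dexp a t : is_derive t (1 : R) (fun s => e s * expR (a * s))
    ((de t + a * e t) * expR (a * t)).
  have d1 := is_derive_scale a (is_derive_id t (1 : R)).
  have := is_derive_mul (d t) (is_derive_comp d1 (is_derive_expR _)).
  by move=> /is_derive_eq; apply; ring.
have e_le0 a t : e t * expR (a * t) <= 0 -> e t = 0.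
  rewrite pmulr_lle0 ?expR_gt0// => et; apply/eqP.
  by rewrite eq_le et e_ge0.
exists r => //= t /= tr; have [t0t|tt0] := leP t0 t.
  have [c /andP[c1 c2]] := MVT_cc (dexp (- C)) t0t.
  rewrite et0 mul0r subr0 => E; apply: (e_le0 (- C)); rewrite E.
  have /deC : `|t0 - c| < r.
    by move: tr; rewrite !ler0_norm ?subr_le0//; lra.
  rewrite ler_norml => /andP[_ dec].
  by rewrite mulr_le0_ge0 ?subr_ge0// pmulr_lle0 ?expR_gt0//; lra.
have [c /andP[c1 c2]] := MVT_cc (dexp C) (ltW tt0).
rewrite et0 mul0r sub0r => E; apply: (e_le0 C); rewrite -[leLHS]opprK E oppr_le0.
have /deC : `|t0 - c| < r.
  move: tr; rewrite !ger0_norm ?subr_ge0// ?(ltW tt0)//.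
  by apply: le_lt_trans; rewrite lerD2l lerN2.
rewrite ler_norml => /andP[dec _].
by rewrite mulr_ge0 ?subr_ge0 ?(ltW tt0)// pmulr_lge0 ?expR_gt0//; lra.
Qed.

(** Connectedness of the line; it spreads local uniqueness from one time to all times. *)
Lemma clopen_setT {R : realType} (P : set R) (t0 : R) : P t0 -> closed P ->
  (forall t, P t -> \forall s \near t, P s) -> forall t, P t.
Proof.
move=> Pt0 cP oP t.
have cT : connected [set: R] by apply/connected_intervalP => x y _ _ z _.
suff -> : P = setT by [].
apply: cT; first by exists t0.
- by exists P; rewrite ?setTI// openE => s /oP.
- by exists P; rewrite ?setTI.
Qed.

(** * Lipschitz estimates along a pair of curves *)

Section LipschitzPairs.
Context {R : realType} {t0 : R} {delta : R -> R}.

(** The two functions are compared at equal times against a common distance [delta]. Continuity at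
    [t0] is carried along because products and inverses need local bounds on their factors. *)
Definition lip (f g : R -> R) :=
  [/\ {for t0, continuous f}, {for t0, continuous g} &
   exists2 L : R, 0 <= L & \forall t \near t0, `|f t - g t| <= L * delta t].

Lemma lip_cst (c : R) : lip (fun=> c) (fun=> c).
Proof.
split; [exact: cvg_cst|exact: cvg_cst|exists 0 => //].
by near=> t; rewrite subrr normr0 mul0r.
Unshelve. all: by end_near. Qed.

Lemma lipD {f1 g1 f2 g2} : lip f1 g1 -> lip f2 g2 ->
  lip (fun t => f1 t + f2 t) (fun t => g1 t + g2 t).
Proof.
move=> [cf1 cg1 [L1 L10 H1]] [cf2 cg2 [L2 L20 H2]]; split.
- exact: cvgD cf1 cf2.
- exact: cvgD cg1 cg2.
exists (L1 + L2); first by rewrite addr_ge0.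
near=> t; rewrite opprD addrACA (le_trans (ler_normD _ _))// mulrDl.
by rewrite lerD//; [near: t|near: t].
Unshelve. all: by end_near. Qed.

Lemma near_bounded {f : R -> R} : {for t0, continuous f} ->
  \forall t \near t0, `|f t| <= `|f t0| + 1.
Proof.
move=> cf; near=> t.
rewrite -[f t](subrK (f t0)) (le_trans (ler_normD _ _))// addrC lerD2l.
rewrite distrC ltW//; near: t; exact: cvgr_dist_lt.
Unshelve. all: by end_near. Qed.

Lemma lipM {f1 g1 f2 g2} : lip f1 g1 -> lip f2 g2 ->
  lip (fun t => f1 t * f2 t) (fun t => g1 t * g2 t).
Proof.
move=> [cf1 cg1 [L1 L10 H1]] [cf2 cg2 [L2 L20 H2]]; split.
- exact: cvgM cf1 cf2.
- exact: cvgM cg1 cg2.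
exists ((`|f1 t0| + 1) * L2 + (`|g2 t0| + 1) * L1).
  by rewrite addr_ge0// mulr_ge0// addr_ge0.
have b1 := near_bounded cf1; have b2 := near_bounded cg2.
near=> t.
have -> : f1 t * f2 t - g1 t * g2 t =
          f1 t * (f2 t - g2 t) + g2 t * (f1 t - g1 t) by ring.
rewrite (le_trans (ler_normD _ _))// !normrM mulrDl -!mulrA.
by rewrite lerD// ler_pM//; near: t.
Unshelve. all: by end_near. Qed.

Lemma lipV {f g} : f t0 != 0 -> g t0 != 0 -> lip f g ->
  lip (fun t => (f t)^-1) (fun t => (g t)^-1).
Proof.
move=> f0 g0 [cf cg [L L0 H]].
have cfi : {for t0, continuous (fun t => (f t)^-1)} by exact: cvgV.
have cgi : {for t0, continuous (fun t => (g t)^-1)} by exact: cvgV.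
split=> //.
exists ((`|(f t0)^-1| + 1) * ((`|(g t0)^-1| + 1) * L)).
  by rewrite !mulr_ge0// addr_ge0.
have b1 := near_bounded cfi; have b2 := near_bounded cgi.
near=> t.
have ft : f t != 0 by near: t; exact: cvgr_neq0 cf f0.
have gt : g t != 0 by near: t; exact: cvgr_neq0 cg g0.
have -> : (f t)^-1 - (g t)^-1 = (f t)^-1 * ((g t)^-1 * (g t - f t)).
  by field; rewrite ft gt.
rewrite !normrM -!mulrA distrC.
by rewrite ler_pM// ?mulr_ge0//; [near: t|rewrite ler_pM//; near: t].
Unshelve. all: by end_near. Qed.

Lemma lip_sum {I : finType} {f g : I -> R -> R} :
  (forall i, lip (f i) (g i)) ->
  lip (fun t => \sum_i f i t) (fun t => \sum_i g i t).
Proof.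
move=> fg.
have E h : (fun t => \sum_i h i t) = \sum_i (h i : R -> R) :> (R -> R).
  by apply/funext => t; rewrite fct_sumE.
rewrite !E; elim/big_rec2 : _ => [|i F G _ FG]; first exact: lip_cst.
exact: lipD.
Qed.

Definition lipmx {m n} (A B : R -> 'M[R]_(m, n)) :=
  forall i j, lip (fun t => A t i j) (fun t => B t i j).

Lemma lipmxD {m n} {A1 B1 A2 B2 : R -> 'M[R]_(m, n)} :
  lipmx A1 B1 -> lipmx A2 B2 ->
  lipmx (fun t => A1 t + A2 t) (fun t => B1 t + B2 t).
Proof.
move=> h1 h2 i j.
have := lipD (h1 i j) (h2 i j).
by congr lip; apply/funext => t; rewrite mxE.
Qed.

Lemma lipmxM {m n p} {A1 B1 : R -> 'M[R]_(m, n)}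
    {A2 B2 : R -> 'M[R]_(n, p)} :
  lipmx A1 B1 -> lipmx A2 B2 ->
  lipmx (fun t => A1 t *m A2 t) (fun t => B1 t *m B2 t).
Proof.
move=> h1 h2 i j.
have := lip_sum (fun k => lipM (h1 i k) (h2 k j)).
by congr lip; apply/funext => t; rewrite mxE.
Qed.

Lemma lipmx_tr {m n} {A B : R -> 'M[R]_(m, n)} :
  lipmx A B -> lipmx (fun t => (A t)^T) (fun t => (B t)^T).
Proof.
move=> h i j; have := h j i.
by congr lip; apply/funext => t; rewrite mxE.
Qed.

Lemma lipmx_scale {m n} {f g : R -> R} {A B : R -> 'M[R]_(m, n)} :
  lip f g -> lipmx A B ->
  lipmx (fun t => f t *: A t) (fun t => g t *: B t).
Proof.
move=> h1 h2 i j; have := lipM h1 (h2 i j).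
by congr lip; apply/funext => t; rewrite mxE.
Qed.

Lemma lipmxN {m n} {A B : R -> 'M[R]_(m, n)} :
  lipmx A B -> lipmx (fun t => - A t) (fun t => - B t).
Proof.
move=> h i j; have := lipM (lip_cst (-1)) (h i j).
by congr lip; apply/funext => t; rewrite mxE mulN1r.
Qed.

Lemma lipmx_scalar {n} {f g : R -> R} :
  lip f g -> lipmx (fun t => (f t)%:M : 'M[R]_n) (fun t => (g t)%:M).
Proof.
move=> h i j; have := lipM h (lip_cst ((i == j)%:R)).
by congr lip; apply/funext => t; rewrite mxE mulr_natr.
Qed.

Lemma lip_mxtrace {n} {A B : R -> 'M[R]_n} :
  lipmx A B -> lip (fun t => \tr (A t)) (fun t => \tr (B t)).
Proof. by move=> h; apply: lip_sum => i; exact: h. Qed.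

End LipschitzPairs.
Arguments lipmx {R} t0 delta {m n} A B.

(** The Hilbert-Schmidt inner product; its squared norm is differentiable along curves, unlike the
    maximum norm of matrices. *)
Definition mxdot {R : realType} {m n : nat} (A B : 'M[R]_(m, n)) : R :=
  \sum_i \sum_j A i j * B i j.

Lemma mxdot_ge0 {R : realType} {m n : nat} (A : 'M[R]_(m, n)) : 0 <= mxdot A A.
Proof.
by apply: sumr_ge0 => i _; apply: sumr_ge0 => j _; rewrite -expr2 sqr_ge0.
Qed.

Lemma entry_le_sqrt_mxdot {R : realType} {m n : nat} (A : 'M[R]_(m, n)) i j :
  `|A i j| <= Num.sqrt (mxdot A A).
Proof.
rewrite -sqrtr_sqr ler_wsqrtr// /mxdot (bigD1 i)//= (bigD1 j)//= -expr2.
rewrite -addrA lerDl addr_ge0//; last apply: sumr_ge0 => k _;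
  by apply: sumr_ge0 => l _; rewrite -expr2 sqr_ge0.
Qed.

Lemma is_derive_fsum {R : realType} {n : nat} {f : 'I_n -> R -> R}
    {df : 'I_n -> R} {t : R} : (forall i, is_derive t (1 : R) (f i) (df i)) ->
  is_derive t (1 : R) (fun s => \sum_i f i s) (\sum_i df i).
Proof.
move=> /is_derive_sum; congr (is_derive _ _ _ _).
by apply/funext => s; rewrite fct_sumE.
Qed.

Lemma is_derive_mxdot {R : realType} {m n : nat} {A : R -> 'M[R]_(m, n)}
    {D : 'M[R]_(m, n)} {t : R} : is_derive t 1 A D ->
  is_derive t (1 : R) (fun s => mxdot (A s) (A s)) (2 * mxdot (A t) D).
Proof.
move=> /is_derive_mxP dA.
have := is_derive_fsum (fun i => is_derive_fsum (fun j =>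
          is_derive_mul (dA i j) (dA i j))).
move=> /is_derive_eq; apply; rewrite /mxdot mulr_sumr; apply: eq_bigr => i _.
by rewrite mulr_sumr; apply: eq_bigr => j _; ring.
Qed.

(** Entrywise, one factor is at most [delta] and the other at most a constant times [delta]. This
    bounds the derivative of a squared distance by a multiple of that squared distance. *)
Lemma near_mxdot_le {R : realType} {t0 : R} {delta : R -> R} {m n : nat}
    {D F G : R -> 'M[R]_(m, n)} : lipmx t0 delta F G ->
  (forall t i j, `|D t i j| <= delta t) ->
  exists C : R, \forall t \near t0,
    `|mxdot (D t) (F t - G t)| <= C * delta t ^+ 2.
Proof.
move=> FG Dd.
pose bnd (f : R -> R) :=
  exists C : R, \forall t \near t0, `|f t| <= C * delta t ^+ 2.
have bnd_sum (I : finType) (f : I -> R -> R) : (forall i, bnd (f i)) ->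
    bnd (fun t => \sum_i f i t).
  move=> bf.
  rewrite (_ : (fun t => _) = \sum_i (f i : R -> R)); last first.
    by apply/funext => t; rewrite fct_sumE.
  elim/big_rec : _ => [|i F' _ [C2 H2]].
    by exists 0; near=> t; rewrite normr0 mul0r.
  have [C1 H1] := bf i; exists (C1 + C2); near=> t.
  by rewrite (le_trans (ler_normD _ _))// mulrDl lerD//; near: t.
apply: (bnd_sum) => i; apply: (bnd_sum) => j.
have [_ _ [L L0 H]] := FG i j; exists L; near=> t.
rewrite normrM mulrC expr2 mulrA ler_pM// !mxE.
by near: t.
Unshelve. all: by end_near. Qed.

(** The right-hand side uses only products, sums and division by the trace, which all respect [lip].
    Hence near a time of agreement the derivative of the squared distance [dot] is at most a
    multiple of [dot], and [dot] stays 0. *)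
Lemma geodesic_system_unique {R : realType} {n : nat}
    {b1 o1 z1 b2 o2 z2 : R -> 'M[R]_n} :
  geodesic_system b1 o1 z1 -> geodesic_system b2 o2 z2 ->
  (forall t, \tr (b1 t) != 0) ->
  b1 0 = b2 0 -> o1 0 = o2 0 -> z1 0 = z2 0 ->
  forall t, [/\ b1 t = b2 t, o1 t = o2 t & z1 t = z2 t].
Proof.
move=> s1 s2 tr1 b0 o0 z0.
pose dot t := mxdot (b1 t - b2 t) (b1 t - b2 t) +
  (mxdot (z1 t - z2 t) (z1 t - z2 t) + mxdot (o1 t - o2 t) (o1 t - o2 t)).
have dot_ge0 t : 0 <= dot t by rewrite !addr_ge0 ?mxdot_ge0.
pose F (b o : R -> 'M[R]_n) t := - (b t *m o t *m b t).
pose G (b o z : R -> 'M[R]_n) t :=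
  2^-1 *: ((o t + z t)^T *m b t *m (o t + z t))
  + (2^-1 * (\tr (o t *m b t *m o t *m b t) / \tr (b t)))%:M
  + (2^-1 * (\tr (z t *m b t *m z t *m b t) / \tr (b t)))%:M.
pose de t := 2 * mxdot (b1 t - b2 t) (F b1 o1 t - F b2 o2 t) +
  (2 * mxdot (z1 t - z2 t) (0 - 0) +
   2 * mxdot (o1 t - o2 t) (G b1 o1 z1 t - G b2 o2 z2 t)).
have dde t : is_derive t (1 : R) dot (de t).
  have [b1' z1' o1'] := s1 t; have [b2' z2' o2'] := s2 t.
  exact: is_deriveD (is_derive_mxdot (is_deriveB b1' b2'))
     (is_deriveD (is_derive_mxdot (is_deriveB z1' z2'))
                 (is_derive_mxdot (is_deriveB o1' o2'))).
have dot0 t : dot t = 0 -> [/\ b1 t = b2 t, o1 t = o2 t & z1 t = z2 t].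
  have mx0 (A B : 'M[R]_n) : mxdot (A - B) (A - B) = 0 -> A = B.
    move=> AB; apply/matrixP => i j; apply/eqP; rewrite -subr_eq0 -normr_le0.
    by have := entry_le_sqrt_mxdot (A - B) i j; rewrite AB sqrtr0 !mxE.
  have h1 := mxdot_ge0 (b1 t - b2 t); have h2 := mxdot_ge0 (z1 t - z2 t).
  have h3 := mxdot_ge0 (o1 t - o2 t).
  by rewrite /dot => E; split; apply: mx0; lra.
suff : forall t, dot t = 0 by move=> h t; exact: dot0.
apply: (@clopen_setT R (fun t => dot t = 0) 0).
- rewrite /dot b0 o0 z0 !subrr /mxdot.
  by rewrite !big1 ?addr0// => i _; rewrite big1// => j _; rewrite mxE mul0r.
- have /continuous_closedP cdot := is_derive_continuous dde.
  exact: (cdot _ (@closed_eq R 0)).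
move=> t0 t00.
have [eb eo ez] := dot0 _ t00.
pose delta t := Num.sqrt (dot t).
have dE t : delta t ^+ 2 = dot t by rewrite sqr_sqrtr.
have mxc (A DA : R -> 'M[R]_n) : (forall t : R, is_derive t 1 A (DA t)) ->
    forall i j, {for t0, continuous (fun t => A t i j)}.
  move=> dA i j.
  exact: is_derive_continuous (fun t => (is_derive_mxP _ _ _).1 (dA t) i j) t0.
have le_b t i j : `|(b1 t - b2 t) i j| <= delta t.
  rewrite (le_trans (entry_le_sqrt_mxdot _ _ _))// ler_wsqrtr// lerDl.
  by rewrite addr_ge0 ?mxdot_ge0.
have le_z t i j : `|(z1 t - z2 t) i j| <= delta t.
  rewrite (le_trans (entry_le_sqrt_mxdot _ _ _))// ler_wsqrtr// /dot addrCA lerDl.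
  by rewrite addr_ge0 ?mxdot_ge0.
have le_o t i j : `|(o1 t - o2 t) i j| <= delta t.
  rewrite (le_trans (entry_le_sqrt_mxdot _ _ _))// ler_wsqrtr// /dot addrA lerDr.
  by rewrite addr_ge0 ?mxdot_ge0.
have lip_of (A B DA DB : R -> 'M[R]_n) :
    (forall t : R, is_derive t 1 A (DA t)) ->
    (forall t : R, is_derive t 1 B (DB t)) ->
    (forall t i j, `|(A t - B t) i j| <= delta t) -> lipmx t0 delta A B.
  move=> dA dB AB i j; split.
  - exact: mxc dA i j.
  - exact: mxc dB i j.
  exists 1 => //.
  by near=> t; rewrite mul1r; have := AB t i j; rewrite !mxE.
have lb : lipmx t0 delta b1 b2.
  by apply: lip_of le_b => t; [have [] := s1 t|have [] := s2 t].
have lz : lipmx t0 delta z1 z2.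
  by apply: lip_of le_z => t; [have [] := s1 t|have [] := s2 t].
have lo : lipmx t0 delta o1 o2.
  by apply: lip_of le_o => t; [have [] := s1 t|have [] := s2 t].
have lF : lipmx t0 delta (F b1 o1) (F b2 o2).
  exact: lipmxN (lipmxM (lipmxM lb lo) lb).
have lG : lipmx t0 delta (G b1 o1 z1) (G b2 o2 z2).
  (* The solutions agree at [t0], so the nonzero trace passes from the first to the second. *)
  have tr2 : \tr (b2 t0) != 0 by rewrite -eb.
  have lbV := lipV (tr1 t0) tr2 (lip_mxtrace lb).
  have c2 := @lip_cst R t0 delta 2^-1.
  have l4 A B : lipmx t0 delta A B ->
      lipmx t0 delta (fun t => (2^-1 * (\tr (A t *m b1 t *m A t *m b1 t)
                                      / \tr (b1 t)))%:M : 'M[R]_n)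
                     (fun t => (2^-1 * (\tr (B t *m b2 t *m B t *m b2 t)
                                      / \tr (b2 t)))%:M).
    move=> AB; apply: lipmx_scalar.
    have ltr := lip_mxtrace (lipmxM (lipmxM (lipmxM AB lb) AB) lb).
    exact: lipM c2 (lipM ltr lbV).
  apply: lipmxD; last exact: l4.
  apply: lipmxD; last exact: l4.
  apply: lipmx_scale => //; apply: lipmxM; last exact: lipmxD.
  by apply: lipmxM => //; apply: lipmx_tr; exact: lipmxD.
have [Cb Hb] := near_mxdot_le lF le_b.
have [Co Ho] := near_mxdot_le lG le_o.
(* The factor 2 comes from differentiating squares; the [zeta] part adds nothing, both derivatives
   being 0. *)
apply: (@gronwall_eq0 R dot de (2 * (Cb + Co))) => //.
near=> t.
have mxdot0 (A : 'M[R]_n) : mxdot A (0 - 0) = 0.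
  rewrite subrr /mxdot big1// => i _.
  by rewrite big1// => j _; rewrite mxE mulr0.
rewrite /de mxdot0 mulr0 add0r -mulrDr normrM ger0_norm// -mulrA ler_pM2l//.
rewrite (le_trans (ler_normD _ _))// -dE mulrDl.
by rewrite lerD//; near: t.
Unshelve. all: by end_near. Qed.

(** * Block-diagonal solutions *)

Lemma castmxM {R : realType} {a b : nat} (e : a = b) (A B : 'M[R]_a) :
  castmx (e, e) A *m castmx (e, e) B = castmx (e, e) (A *m B).
Proof. by case: _ / e. Qed.

Lemma castmx_scalar {R : realType} {a b : nat} (e : a = b) (c : R) :
  castmx (e, e) c%:M = c%:M.
Proof. by case: _ / e. Qed.

Lemma mxtrace_castmx {R : realType} {a b : nat} (e : a = b) (A : 'M[R]_a) :
  \tr (castmx (e, e) A) = \tr A.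
Proof. by case: _ / e. Qed.

Lemma castmxD {R : realType} {a b : nat} (e : a = b) (A B : 'M[R]_a) :
  castmx (e, e) A + castmx (e, e) B = castmx (e, e) (A + B).
Proof. by case: _ / e. Qed.

Lemma castmx_scale {R : realType} {a b : nat} (e : a = b) (c : R)
    (A : 'M[R]_a) : c *: castmx (e, e) A = castmx (e, e) (c *: A).
Proof. by case: _ / e. Qed.

Lemma Z2sum_tr {R : realType} (m : nat) (z : R) : (Z2sum m z)^T = - Z2sum m z.
Proof.
have trZ : (z *: Z2 R)^T = - (z *: Z2 R).
  by rewrite /Z2 linearZ linearB /= !trmx_delta -scalerN opprB.
rewrite /Z2sum trmx_cast /= tr_mxdiag -scaleN1r castmx_scale scaleN1r -mxdiagN.
by congr castmx; apply: eq_mxdiag => i; exact: trZ.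
Qed.

(** [Z2] is a quarter turn, so its square is minus the identity. The rotation thus enters the
    [omega] equation only through scalars, and the block scalar form survives. *)
Lemma Z2sum_sqr {R : realType} (m : nat) (z : R) :
  Z2sum m z *m Z2sum m z = (- z ^+ 2)%:M.
Proof.
have ZZ : (z *: Z2 R) *m (z *: Z2 R) = (- z ^+ 2)%:M.
  apply/matrixP => -[[|[|//]] ?] [[|[|//]] ?];
    by rewrite /Z2 !mxE !big_ord_recl big_ord0 !mxE /=; ring.
rewrite /Z2sum castmxM -(castmx_scalar (sum2E m)) -mxdiagZ; congr castmx.
rewrite {2}/mxdiag mul_mxdiag_mxblock /mxdiag; apply: eq_mxblock => i j.
case: eqP => [_|]; last by rewrite mulmx0.
by rewrite !conform_mx_id ZZ.
Qed.

Lemma mxtrace_scalarE {R : realType} (m : nat) (c : R) :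
  \tr (c%:M : 'M[R]_m) = m%:R * c.
Proof. by rewrite mxtrace_scalar mulr_natl. Qed.

Section BlockCurves.
Context {R : realType} {n p : nat} (hp : (p <= n)%N).
Implicit Types (A C : 'M[R]_p) (B D : 'M[R]_(n - p)) (a b : R).

Lemma dsumM A B C D : dsum hp A B *m dsum hp C D = dsum hp (A *m C) (B *m D).
Proof.
by rewrite /dsum castmxM mulmx_block !mulmx0 !mul0mx !addr0 !add0r.
Qed.

Lemma dsumD A B C D : dsum hp A B + dsum hp C D = dsum hp (A + C) (B + D).
Proof. by rewrite /dsum castmxD add_block_mx !addr0. Qed.

Lemma dsumZ a A B : a *: dsum hp A B = dsum hp (a *: A) (a *: B).
Proof. by rewrite /dsum castmx_scale scale_block_mx !scaler0. Qed.

Lemma dsumN A B : - dsum hp A B = dsum hp (- A) (- B).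
Proof. by rewrite -scaleN1r dsumZ !scaleN1r. Qed.

Lemma dsum_tr A B : (dsum hp A B)^T = dsum hp A^T B^T.
Proof. by rewrite /dsum trmx_cast tr_block_mx !trmx0. Qed.

Lemma mxtrace_dsum A B : \tr (dsum hp A B) = \tr A + \tr B.
Proof. by rewrite /dsum mxtrace_castmx mxtrace_block. Qed.

Lemma dsum_scalar a : a%:M = dsum hp a%:M a%:M.
Proof. by rewrite /dsum -scalar_mx_block castmx_scalar. Qed.

Lemma is_derive_dsum_scalar {f g : R -> R} {df dg t : R} :
  is_derive t (1 : R) f df -> is_derive t (1 : R) g dg ->
  is_derive t 1 (fun s => dsum hp (f s)%:M (g s)%:M) (dsum hp df%:M dg%:M).
Proof.
move=> f' g'.
(* A block scalar matrix is a combination of two constant matrices, so only the two coefficients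
   need differentiating. *)
have E a b : dsum hp a%:M b%:M = a *: dsum hp 1%:M 0 + b *: dsum hp 0 1%:M.
  by rewrite !dsumZ dsumD !scale_scalar_mx !mulr1 !scaler0 add0r addr0.
apply/is_derive_mxP => i j; rewrite E !mxE.
have := is_deriveD (is_derive_mul f' (is_derive_cst (dsum hp 1%:M 0 i j) t 1))
                   (is_derive_mul g' (is_derive_cst (dsum hp 0 1%:M i j) t 1)).
rewrite !mulr0 !addr0.
by congr (is_derive _ _ _ _); apply/funext => s; rewrite E !mxE.
Qed.
End BlockCurves.

Lemma powR_expR {R : realType} (a c : R) : expR a `^ c = expR (c * a).
Proof. by rewrite /powR gt_eqF ?expR_gt0// expRK. Qed.

Lemma omega_formE {R : realType} {n m0 : nat} (hn : (2 * m0 < n)%N) (b v : R) :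
  omega_form hn (expR b) v =
  dsum (ltnW hn) ((2 * m0)%:R^-1 * v / expR (b / (2 * m0)%:R))%:M
                 (- (n - 2 * m0)%:R^-1 * v / expR (- b / (n - 2 * m0)%:R))%:M.
Proof.
rewrite /omega_form !powR_expR -!expRN.
congr (dsum _ (_ * expR _)%:M (_ * expR _)%:M).
  by rewrite mulNr mulrC.
by rewrite -mulNr opprK mulrC.
Qed.

(** The [beta] equation reads [b' = - w] in both blocks. The [omega] equation gives one equation for
    [w'] per block, and the trace terms make both agree with [accel]. *)
Lemma geodesic_system_block {R : realType} {n m0 : nat} (hm0 : (1 <= m0)%N)
    (hn : (2 * m0 < n)%N) {z : R} {b w : R -> R} :
  (forall t, is_derive t (1 : R) b (- w t)) ->
  (forall t, is_derive t (1 : R) w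
     (accel (2 * m0)%:R (n - 2 * m0)%:R z (b t) (w t))) ->
  geodesic_system (fun t => dsum (ltnW hn) (expR (b t / (2 * m0)%:R))%:M
                                 (expR (- b t / (n - 2 * m0)%:R))%:M)
    (fun t => omega_form hn (expR (b t)) (w t)) (fun=> zeta_form hn z).
Proof.
set p : R := (2 * m0)%:R; set q : R := (n - 2 * m0)%:R => db dw.
have p0 : 0 < p by rewrite ltr0n muln_gt0.
have q0 : 0 < q by rewrite ltr0n subn_gt0.
have pn0 : p != 0 by rewrite gt_eqF.
have qn0 : q != 0 by rewrite gt_eqF.
pose x s := expR (b s / p); pose y s := expR (- b s / q).
have x0 s : x s != 0 by rewrite gt_eqF// expR_gt0.
have y0 s : y s != 0 by rewrite gt_eqF// expR_gt0.
have dx t : is_derive t (1 : R) x (- (p^-1 * w t * x t)).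
  have := is_derive_comp (is_derive_mul (db t) (is_derive_cst p^-1 t 1))
                         (is_derive_expR _).
  by move=> /is_derive_eq; apply; rewrite /= mulr0 addr0 /x; ring.
have dy t : is_derive t (1 : R) y (q^-1 * w t * y t).
  have := is_derive_comp (is_derive_mul (is_derive_scale (-1) (db t))
                           (is_derive_cst q^-1 t 1)) (is_derive_expR _).
  have -> : (fun s => expR (-1 * b s * q^-1)) = y.
    by apply/funext => s; rewrite mulN1r.
  by move=> /is_derive_eq; apply; rewrite /= mulr0 addr0 mulN1r /y; ring.
pose o1 s : R := p^-1 * w s / x s; pose o2 s : R := - q^-1 * w s / y s.
have oE : (fun s => omega_form hn (expR (b s)) (w s)) =
          (fun s => dsum (ltnW hn) (o1 s)%:M (o2 s)%:M).
  by apply/funext => s; rewrite omega_formE.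
rewrite oE.
change (geodesic_system (fun s => dsum (ltnW hn) (x s)%:M (y s)%:M)
  (fun s => dsum (ltnW hn) (o1 s)%:M (o2 s)%:M) (fun=> zeta_form hn z)).
have pE : (2 * m0)%:R = p by [].
have qE : (n - 2 * m0)%:R = q by [].
have xE s : expR (b s / p) = x s by [].
have yE s : expR (- b s / q) = y s by [].
have xV s : expR (- b s / p) = (x s)^-1 by rewrite mulNr expRN.
have yV s : expR (b s / q) = (y s)^-1 by rewrite -yE mulNr expRN invrK.
have x_gt0 s : 0 < x s by exact: expR_gt0.
have y_gt0 s : 0 < y s by exact: expR_gt0.
have o1E s : o1 s = p^-1 * w s / x s by [].
have o2E s : o2 s = - q^-1 * w s / y s by [].
clearbody o1 o2 x y p q; move=> t; split.
- have := is_derive_dsum_scalar (ltnW hn) (dx t) (dy t).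
  move=> /is_derive_eq; apply.
  rewrite !dsumM -!scalar_mxM dsumN -!raddfN /=.
  congr (dsum _ _%:M _%:M); first by rewrite o1E; field; rewrite pn0 x0.
  by rewrite o2E; field; rewrite qn0 y0.
- exact: is_derive_cst.
have do1 := is_derive_mul
  (is_derive_scale p^-1 (dw t)) (is_derive_inv (dx t) (x0 t)).
have do2 := is_derive_mul
  (is_derive_scale (- q^-1) (dw t)) (is_derive_inv (dy t) (y0 t)).
rewrite -(funext o1E) in do1; rewrite -(funext o2E) in do2.
have := is_derive_dsum_scalar (ltnW hn) do1 do2.
move=> /is_derive_eq; apply.
(* In the first block, with [Z] for [Z2sum m0 z], this is [x * (o1 - Z) * (o1 + Z)]: the cross terms
   cancel and [- Z ^+ 2] contributes [z ^+ 2]. *)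
have -> : (dsum (ltnW hn) (o1 t)%:M (o2 t)%:M + zeta_form hn z)^T
     *m dsum (ltnW hn) (x t)%:M (y t)%:M
     *m (dsum (ltnW hn) (o1 t)%:M (o2 t)%:M + zeta_form hn z) =
   dsum (ltnW hn) (x t * (o1 t ^+ 2 + z ^+ 2))%:M (y t * o2 t ^+ 2)%:M.
  rewrite /zeta_form dsumD dsum_tr !dsumM addr0; congr dsum.
    have -> : ((o1 t)%:M + Z2sum m0 z)^T = (o1 t)%:M - Z2sum m0 z.
      by rewrite [LHS]linearD /= tr_scalar_mx Z2sum_tr.
    rewrite mul_mx_scalar -scalemxAl mulmxBl !mulmxDr Z2sum_sqr -scalar_mxM.
    rewrite mul_mx_scalar mul_scalar_mx opprD addrA addrK.
    by rewrite -raddfN -raddfD /= opprK scale_scalar_mx -expr2.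
  by rewrite tr_scalar_mx -!scalar_mxM; congr _%:M; ring.
have -> : \tr (dsum (ltnW hn) (o1 t)%:M (o2 t)%:M *m
    dsum (ltnW hn) (x t)%:M (y t)%:M *m dsum (ltnW hn) (o1 t)%:M (o2 t)%:M *m
    dsum (ltnW hn) (x t)%:M (y t)%:M) =
    p * (o1 t * x t) ^+ 2 + q * (o2 t * y t) ^+ 2.
  rewrite !dsumM mxtrace_dsum -!scalar_mxM !mxtrace_scalarE.
  by rewrite pE qE !expr2 !mulrA.
have -> : \tr (zeta_form hn z *m dsum (ltnW hn) (x t)%:M (y t)%:M *m
    zeta_form hn z *m dsum (ltnW hn) (x t)%:M (y t)%:M) = - (p * (x t * z) ^+ 2).
  rewrite /zeta_form !dsumM mxtrace_dsum !mul0mx mxtrace0 addr0.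
  rewrite !mul_mx_scalar -scalemxAl Z2sum_sqr !mxtraceZ mxtrace_scalarE.
  by rewrite pE; ring.
have -> : \tr (dsum (ltnW hn) (x t)%:M (y t)%:M) = p * x t + q * y t.
  by rewrite mxtrace_dsum !mxtrace_scalarE pE qE.
have T0 : p * x t + q * y t != 0 by rewrite gt_eqF// addr_gt0// mulr_gt0.
(* [kinetic] is the trace of [beta] divided by [p * q * x * y]; this matches the denominator of
   [accel] with the trace in the system. *)
have kE : kinetic p q (b t) = (p * x t + q * y t) / (p * q * x t * y t).
  by rewrite /kinetic xV yV; field; rewrite x0 y0 pn0 qn0.
have dkE : dkinetic p q (b t) = q^-1 ^+ 2 / y t - p^-1 ^+ 2 / x t.
  by rewrite /dkinetic xV yV.
rewrite dsumZ !(dsum_scalar (ltnW hn)) !dsumD !scale_scalar_mx -!raddfD /=.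
by congr (dsum _ _%:M _%:M); rewrite /accel kE dkE xE o1E o2E; field;
   rewrite T0 x0 y0 pn0 qn0.
Qed.

(** * Existence, uniqueness and behaviour of [b] *)

Lemma not_bounded_fun {R : realType} (f : R -> R) :
  (forall M : R, exists t, f t < M) -> ~ bounded_fun f.
Proof.
move=> funb [M [_ fM]]; have [t ft] := funb (- (M + 1)).
have /fM /(_ t I) /= ftM : M < M + 1 by rewrite ltrDl.
have := lt_le_trans (_ : M + 1 < - f t) (ler_norm (- f t)).
by rewrite normrN ltrNr => /(_ ft); rewrite ltNge ftM.
Qed.

(** The constructed solution gives existence, and uniqueness transfers its form to every solution.
    If [z0 = 0] and [v = 0] it is stationary with [b] constant, hence the conditions on [z0] and [v]
    for unboundedness and monotonicity. *)
Theorem theorem5p9 (R : realType) (n m0 : nat) (hm0 : (1 <= m0)%N)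
    (hn : (2 * m0 < n)%N) (beta0 z0 v : R) (hbeta0 : 0 < beta0) :
  (exists beta omega zeta : R -> 'M[R]_n,
     [/\ geodesic_system beta omega zeta,
         beta 0 = beta_form hn beta0,
         zeta 0 = zeta_form hn z0 &
         omega 0 = omega_form hn beta0 v]) /\
  forall beta omega zeta : R -> 'M[R]_n,
    geodesic_system beta omega zeta ->
    beta 0 = beta_form hn beta0 ->
    zeta 0 = zeta_form hn z0 ->
    omega 0 = omega_form hn beta0 v ->
    exists b w : R -> R,
      [/\ (forall t : R,
             [/\ beta t = dsum (ltnW hn)
                            (expR (b t / (2 * m0)%:R))%:M
                            (expR (- (b t) / (n - 2 * m0)%:R))%:M,
                 omega t = omega_form hn (expR (b t)) (w t) &
                 zeta t = zeta_form hn z0]),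
          (z0 != 0 \/ v != 0 -> ~ bounded_fun b),
          (z0 != 0 -> (b t @[t --> +oo] --> -oo) /\
                      (b t @[t --> -oo] --> -oo)) &
          (z0 = 0 -> v != 0 ->
             ({homo b : s t / s < t} \/ {homo b : s t /~ s < t}) /\
             (forall y : R, exists t : R, b t = y))].
Proof.
set p : R := (2 * m0)%:R; set q : R := (n - 2 * m0)%:R.
have p0 : 0 < p by rewrite ltr0n muln_gt0.
have q0 : 0 < q by rewrite ltr0n subn_gt0.
have [b [w [b0 w0 db dw [blim bmono]]]] : exists b w : R -> R,
  [/\ b 0 = ln beta0, w 0 = v, forall t, is_derive t (1 : R) b (- w t),
      forall t, is_derive t (1 : R) w (accel p q z0 (b t) (w t)) &
      (z0 != 0 -> (b t @[t --> +oo] --> -oo) /\ (b t @[t --> -oo] --> -oo)) /\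
      (z0 = 0 -> v != 0 ->
         ({homo b : s t / s < t} \/ {homo b : s t /~ s < t}) /\
         forall y, exists t, b t = y)].
  have [z00|z00] := eqVneq z0 0.
    have [b [w [? ? ? ? ?]]] := reduced_solution_free p q (ln beta0) v p0 q0.
    by exists b, w; rewrite z00; split.
  have [b [w [? ? ? ? ?]]] :=
    reduced_solution_rotating p q z0 (ln beta0) v p0 q0 z00.
  by exists b, w; split=> //; split=> // z0E; rewrite z0E eqxx in z00.
have sys : geodesic_system
    (fun t => dsum (ltnW hn) (expR (b t / p))%:M (expR (- b t / q))%:M)
    (fun t => omega_form hn (expR (b t)) (w t)) (fun=> zeta_form hn z0).
  exact (geodesic_system_block hm0 hn db dw).
have beta_0 : dsum (ltnW hn) (expR (b 0 / p))%:M (expR (- b 0 / q))%:M =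
              beta_form hn beta0.
  rewrite b0 /beta_form -[in RHS](lnK hbeta0) !powR_expR.
  by congr (dsum _ (expR _)%:M (expR _)%:M); rewrite mulrC// mulNr mulrN.
have omega_0 : omega_form hn (expR (b 0)) (w 0) = omega_form hn beta0 v.
  by rewrite b0 w0 lnK.
split.
  by do 3!eexists; split; [exact: sys|exact: beta_0|by []|exact: omega_0].
have pE : (2 * m0)%:R = p by [].
have qE : (n - 2 * m0)%:R = q by [].
clearbody p q.
move=> beta omega zeta sys' beta'0 zeta'0 omega'0; exists b, w.
split; [| |exact: blim|exact: bmono].
(* Uniqueness asks for a nonzero trace along one solution, and the constructed one has positive
   trace. *)
- have tr_neq0 t : \tr (dsum (ltnW hn) (expR (b t / p))%:M
                          (expR (- b t / q))%:M) != 0.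
    rewrite mxtrace_dsum !mxtrace_scalarE pE qE.
    apply/lt0r_neq0/addr_gt0; apply: mulr_gt0; try exact: expR_gt0.
      exact: p0.
    exact: q0.
  move=> t; have [] := geodesic_system_unique sys sys' tr_neq0 _ _ _ t.
  + by rewrite beta_0.
  + by rewrite omega_0.
  + by rewrite zeta'0.
  + by move=> bE oE zE; split; symmetry.
(* [b] takes values below any [M]: by surjectivity when [z0 = 0], by the limit at [+oo]
   otherwise. *)
- move=> zv; apply: not_bounded_fun => M.
  have [z00|z00] := eqVneq z0 0.
    case: zv => [|v0]; first by rewrite z00 eqxx.
    have [_ /(_ (M - 1)) [t bt]] := bmono z00 v0.
    by exists t; rewrite bt gtrBl.
  have [/cvgrNyPlt/(_ M) [A [_ bA]] _] := blim z00.
  by exists (A + 1); apply: bA; rewrite ltrDl.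
Qed.
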